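(* For every index $\mathbf s\in\mathbf I^{\mathrm{ext}}$, $$\zeta_{\mathcal A_K}(\mathbf s)=\bigl(H_{<\deg v}(\mathbf s;\lambda_v)\bmod \lambda_v\bigr)_v\in\mathcal A_K,$$ where $v$ ranges over the monic irreducible polynomials of $A$.
   Context: Let $r$ be a power of a prime $p$, $A=\mathbb F_r[\theta]$, $K=\mathbb F_r(\theta)$, $\mathbb C_\infty$ the completion of an algebraic closure of $\mathbb F_r((1/\theta))$. $A_+$ is the set of monic polynomials, $A_{+,d}$ the monic polynomials of degree $d$. The Carlitz module is $a\mapsto\mathbf C_a(X)=\sum_{i=0}^{\deg a}[a,i]X^{r^i}\in A[X]$, the $\mathbb F_r$-algebra map determined by $\mathbf C_\theta(X)=\theta X+X^r$; $\exp_{\mathbf C}(X)=\sum_{i\ge0}X^{r^i}/D_i$ with $D_i=\prod_{j=0}^{i-1}(\theta^{r^i}-\theta^{r^j})$, $\tilde\pi$ is the Carlitz period ($\ker\exp_{\mathbf C}=\tilde\pi A$), and for $v\in A_+$, $\lambda_v=\exp_{\mathbf C}(\tilde\pi/v)$, a generator of the $v$-torsion $\{u:\mathbf C_v(u)=0\}$. The $u$-bracket is $[a]_u=\mathbf C_a(u)/u$. $\mathbf I^{\mathrm{ext}}$ is the set of finite tuples of integers including $\varnothing$. For $s,d\in\mathbb Z$: $S_d(s)=\sum_{a\in A_{+,d}}a^{-s}$, $H_d(s;u)=\sum_{a\in A_{+,d}}[a]_u^{-s}$; for $\mathbf s=(s_1,\dots,s_m)\ne\varnothing$: $S_{<d}(\mathbf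 s)=\sum_{d>d_1>\cdots>d_m\ge0}\prod_jS_{d_j}(s_j)$, $H_{<d}(\mathbf s;u)=\sum_{d>d_1>\cdots>d_m\ge0}\prod_jH_{d_j}(s_j;u)$; both are $1$ at $\varnothing$. Let $\mathcal A_K=\bigl(\prod_v\mathbb F_v\bigr)/\bigl(\bigoplus_v\mathbb F_v\bigr)$, $v$ over monic irreducibles, $\mathbb F_v=A/(v)$, and $\zeta_{\mathcal A_K}(\mathbf s)=(S_{<\deg v}(\mathbf s)\bmod v)_v\in\mathcal A_K$ (with $\zeta_{\mathcal A_K}(\varnothing)=(1)_v$). In the statement, $H_{<\deg v}(\mathbf s;\lambda_v)$ is an element of $A[\lambda_v]$, and its reduction modulo the prime ideal $(\lambda_v)$ of $A[\lambda_v]$ is regarded as an element of $\mathbb F_v$ via the isomorphism $A/(v)\cong A[\lambda_v]/(\lambda_v)$ induced by inclusion. *)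

(* Defs.v *)
From HB Require Import structures.
From mathcomp Require Import all_boot all_order all_algebra all_field.
From mathcomp Require Import boolp classical_sets functions cardinality reals.
From mathcomp Require Import topology normedtype sequences.

Set Implicit Arguments.
Unset Strict Implicit.
Unset Printing Implicit Defensive.

Import Order.TTheory GRing.Theory Num.Theory numFieldNormedType.Exports.

Local Open Scope classical_set_scope.
Local Open Scope ring_scope.

(* Throughout, F is the finite field with r = #|F| elements, A = {poly F}
   with theta = 'X, and K = {fraction {poly F}}. *)

(* Boolean irreducibility makes a place determined by its polynomial. *)
Record place (F : finFieldType) : Type := Place {
  place_poly :> {poly F};
  placeP : (place_poly \is monic) && irreducibleb place_poly
}.
HB.instance Definition _ (F : finFieldType) := [isSub for @place_poly F].
HB.instance Definition _ (F : finFieldType) := [Choice of place F by <:].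

Lemma place_mi (F : finFieldType) (v : place F) : monic_irreducible_poly v.
Proof. by case/andP: (placeP v) => vm /irreducibleP vi. Qed.

Definition deg (F : finFieldType) (v : place F) : nat := (size v).-1.

Definition Fv (F : finFieldType) (v : place F) : fieldType :=
  {poly %/ v with place_mi v}.

Definition modv (F : finFieldType) (v : place F) (a : {poly F}) : Fv v :=
  in_qpoly v a.

Lemma modv_is_zmod_morphism (F : finFieldType) (v : place F) :
  zmod_morphism (modv v).
Proof. exact: (raddfB (in_qpoly v)). Qed.
HB.instance Definition _ (F : finFieldType) (v : place F) :=
  GRing.isZmodMorphism.Build {poly F} (Fv v) (modv v) (modv_is_zmod_morphism v).

Lemma modv_is_monoid_morphism (F : finFieldType) (v : place F) :
  monoid_morphism (modv v).
Proof. by split; [exact: in_qpoly1 | exact: in_qpolyM]. Qed.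
HB.instance Definition _ (F : finFieldType) (v : place F) :=
  GRing.isMonoidMorphism.Build {poly F} (Fv v) (modv v)
    (modv_is_monoid_morphism v).

Lemma modv_eq0 (F : finFieldType) (v : place F) (a : {poly F}) :
  (modv v a == 0) = (v %| a).
Proof.
have vE : mk_monic v = v :> {poly F} := mk_monicE (place_mi v).
rewrite -val_eqE /= vE /dvdp -Pdiv.IdomainMonic.modpE //.
exact: (place_mi v).2.
Qed.

Lemma irreducible_factor (F : finFieldType) (p : {poly F}) :
  (1 < size p)%N -> exists v : place F, v %| p.
Proof.
have [n] := ubnP (size p); elim: n p => // n IHn p; rewrite ltnS => pn p1.
have p0 : p != 0 by rewrite -size_poly_gt0 (ltn_trans _ p1).
have lp : (lead_coef p)^-1 != 0 by rewrite invr_eq0 lead_coef_eq0.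
have [/irreducibleP pI|/irreducibleP pN] := boolP (irreducibleb p).
  have vP : ((lead_coef p)^-1 *: p \is monic) &&
      irreducibleb ((lead_coef p)^-1 *: p).
    apply/andP; split; first by rewrite monicE lead_coefZ mulVf ?lead_coef_eq0.
    apply/irreducibleP; split; first by rewrite size_scale // pI.
    move=> q q1; rewrite dvdpZr // => /pI -/(_ q1) qp.
    by rewrite (eqp_trans qp) // eqp_sym eqp_scale.
  by exists (Place vP); rewrite /= dvdpZl.
have [q [q1 qp qNp]] : exists q : {poly F}, [/\ size q != 1%N, q %| p & ~~ (q %= p)].
  apply: contrapT => h; apply: pN; split=> // q q1 qp.
  by apply: contrapT => /negP qNp; apply: h; exists q.
have q0 : q != 0 by apply: contraNneq p0 => q0; rewrite -dvd0p -q0.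
have qlt : (size q < size p)%N.
  by rewrite ltn_neqAle dvdp_leq // andbT dvdp_size_eqp.
have [|v vq] := IHn q (leq_trans qlt pn).
  by rewrite ltn_neqAle eq_sym q1 size_poly_gt0.
by exists v; apply: dvdp_trans qp.
Qed.

Lemma infinite_place (F : finFieldType) : ~ finite_set [set: place F].
Proof.
move=> /finite_seqP[s sE].
pose P := \prod_(v <- s) (place_poly v).
have sP (v : place F) : v %| P.
  have vs : v \in s by have : [set: place F] v by []; rewrite sE.
  by rewrite /P (big_rem v vs) /= dvdp_mulr.
have P0 : P != 0.
  by rewrite prodf_seq_neq0; apply/allP => v _; apply: monic_neq0 (place_mi v).2.
have XP : (1 < size ('X * P)%R)%N.
  by rewrite mulrC size_mulX // ltnS size_poly_gt0.
have [|v vd] := @irreducible_factor F ('X * P + 1).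
  by rewrite size_polyDl ?size_poly1.
have /eqP v1 : size v == 1%N.
  by move: vd; rewrite dvdp_addr ?dvdp_mull // dvdp1.
by have := (place_mi v).1.1; rewrite v1.
Qed.

Definition prodF (F : finFieldType) : Type := forall v : place F, Fv v.
HB.instance Definition _ (F : finFieldType) := gen_eqMixin (prodF F).
HB.instance Definition _ (F : finFieldType) := gen_choiceMixin (prodF F).

Section ProdRing.
Context (F : finFieldType).
Implicit Types x y z : prodF F.

Let prodF_add x y : prodF F := fun v => x v + y v.
Let prodF_opp x : prodF F := fun v => - x v.
Let prodF_mul x y : prodF F := fun v => x v * y v.

Fact prodF_addA : associative prodF_add.
Proof. by move=> x y z; apply: functional_extensionality_dep => v; exact: addrA. Qed.
Fact prodF_addC : commutative prodF_add.
Proof. by move=> x y; apply: functional_extensionality_dep => v; exact: addrC. Qed.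
Fact prodF_add0 : left_id ((fun=> 0) : prodF F) prodF_add.
Proof. by move=> x; apply: functional_extensionality_dep => v; exact: add0r. Qed.
Fact prodF_addN : left_inverse ((fun=> 0) : prodF F) prodF_opp prodF_add.
Proof. by move=> x; apply: functional_extensionality_dep => v; exact: addNr. Qed.

HB.instance Definition _ := GRing.isZmodule.Build (prodF F)
  prodF_addA prodF_addC prodF_add0 prodF_addN.

Fact prodF_mulA : associative prodF_mul.
Proof. by move=> x y z; apply: functional_extensionality_dep => v; exact: mulrA. Qed.
Fact prodF_mulC : commutative prodF_mul.
Proof. by move=> x y; apply: functional_extensionality_dep => v; exact: mulrC. Qed.
Fact prodF_mul1 : left_id ((fun=> 1) : prodF F) prodF_mul.
Proof. by move=> x; apply: functional_extensionality_dep => v; exact: mul1r. Qed.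
Fact prodF_mulDl : left_distributive prodF_mul +%R.
Proof. by move=> x y z; apply: functional_extensionality_dep => v; exact: mulrDl. Qed.
Fact prodF_oner_neq0 : ((fun=> 1) : prodF F) != 0.
Proof.
have [|v _] := @irreducible_factor F 'X; first by rewrite size_polyX.
by apply/eqP => /(congr1 (fun x : prodF F => x v))/eqP; rewrite oner_eq0.
Qed.

HB.instance Definition _ := GRing.Zmodule_isComNzRing.Build (prodF F)
  prodF_mulA prodF_mulC prodF_mul1 prodF_mulDl prodF_oner_neq0.

Definition sumF : {pred prodF F} :=
  fun x => `[< finite_set [set v : place F | x v != 0] >].

Fact sumF_idealr : idealr_closed sumF.
Proof.
split.
- apply/asboolP; rewrite (_ : [set _ | _] = set0) //.
  by apply/seteqP; split=> v //=; rewrite eqxx.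
- apply/negP => /asboolP h; apply: (@infinite_place F).
  by apply: sub_finite_set h => v _ /=; exact: oner_neq0.
- move=> a x y /asboolP fx /asboolP fy; apply/asboolP.
  apply: (@sub_finite_set _ _ ([set v | x v != 0] `|` [set v | y v != 0])).
    move=> v /=; apply: contraPP => /not_orP[/negP]; rewrite negbK => /eqP xv.
    move=> /negP; rewrite negbK => /eqP yv; apply/negP; rewrite negbK.
    rewrite (_ : (a * x + y) v = a v * x v + y v) //.
    by rewrite xv yv mulr0 addr0.
  by rewrite finite_setU.
Qed.

HB.instance Definition _ := isIdealr.Build (prodF F) sumF sumF_idealr.

End ProdRing.

Definition AK (F : finFieldType) : comNzRingType := {ideal_quot (@sumF F)}.

Definition toAK (F : finFieldType) (x : prodF F) : AK F :=
  (\pi_({ideal_quot (@sumF F)}) x)%qT.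

Lemma toAKP (F : finFieldType) (x y : prodF F) :
  toAK x = toAK y <-> finite_set [set v : place F | x v != y v].
Proof.
have -> : [set v : place F | x v != y v] = [set v | (x - y) v != 0].
  by apply: eq_set => v; rewrite -(subr_eq0 (x v)).
split=> [/eqP|h].
  by rewrite -Quotient.idealrBE => /asboolP.
by apply/eqP; rewrite -Quotient.idealrBE; apply/asboolP.
Qed.

Definition power_sum (F : finFieldType) (E : unitRingType) (f : {poly F} -> E)
    (d : nat) (s : int) : E :=
  \sum_(a : {poly_(d.+1) F} | ((a : {poly F}) \is monic) && (size a == d.+1))
    f a ^ (- s).

Definition nested_sum (E : pzRingType) (g : nat -> int -> E) (d : nat)
    (s : seq int) : E :=
  \sum_(t : (size s).-tuple 'I_d | sorted (fun i j : 'I_d => (j < i)%N) t)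
    \prod_(j < size s) g (tnth t j) s`_j.

Definition Slt (F : finFieldType) (d : nat) (s : seq int) :
    {fraction {poly F}} :=
  nested_sum (power_sum (fun a : {poly F} => tofrac a)) d s.

(* Reduction modulo v of the elements of K that are integral at v
   (0 by convention on the others) *)
Definition redK (F : finFieldType) (v : place F) (x : {fraction {poly F}}) :
    Fv v :=
  xget 0 [set y | exists a b : {poly F},
    [/\ ~~ (v %| b), x = tofrac a / tofrac b & y = modv v a / modv v b]].

Lemma redKE (F : finFieldType) (v : place F) (a b : {poly F}) :
  ~~ (v %| b) -> redK v (tofrac a / tofrac b) = modv v a / modv v b.
Proof.
move=> vb; apply: xget_unique; first by exists a, b.
move=> _ [c [d [vd eab ->]]].
have b0 : b != 0 by apply: contraNneq vb => ->; exact: dvdp0.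
have d0 : d != 0 by apply: contraNneq vd => ->; exact: dvdp0.
move/eqP: eab; rewrite eqr_div ?tofrac_eq0 // -!tofracM tofrac_eq => /eqP eab.
by apply/eqP; rewrite eqr_div ?modv_eq0 // -!rmorphM eab.
Qed.

Definition v_integral (F : finFieldType) (v : place F)
    (x : {fraction {poly F}}) : Prop :=
  exists a b : {poly F}, ~~ (v %| b) /\ x = tofrac a / tofrac b.

Lemma place_dvdM (F : finFieldType) (v : place F) (a b : {poly F}) :
  (v %| a * b) = (v %| a) || (v %| b).
Proof. by rewrite -!modv_eq0 rmorphM mulf_eq0. Qed.

Lemma place_dvd_neq0 (F : finFieldType) (v : place F) (b : {poly F}) :
  ~~ (v %| b) -> tofrac b != 0.
Proof. by rewrite tofrac_eq0; apply: contraNneq => ->; exact: dvdp0. Qed.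

Lemma v_integral_tofrac (F : finFieldType) (v : place F) (a : {poly F}) :
  v_integral v (tofrac a).
Proof.
exists a, 1; by rewrite tofrac1 divr1 -modv_eq0 rmorph1 oner_eq0.
Qed.

Lemma v_integralD (F : finFieldType) (v : place F) (x y : {fraction {poly F}}) :
  v_integral v x -> v_integral v y -> v_integral v (x + y).
Proof.
move=> [a [b [vb ->]]] [c [d [vd ->]]]; exists (a * d + c * b), (b * d).
split; first by rewrite place_dvdM negb_or vb vd.
rewrite (addf_div _ _ (place_dvd_neq0 vb) (place_dvd_neq0 vd)).
by rewrite tofracD !tofracM.
Qed.

Lemma v_integralM (F : finFieldType) (v : place F) (x y : {fraction {poly F}}) :
  v_integral v x -> v_integral v y -> v_integral v (x * y).
Proof.
move=> [a [b [vb ->]]] [c [d [vd ->]]]; exists (a * c), (b * d).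
split; first by rewrite place_dvdM negb_or vb vd.
by rewrite mulf_div !tofracM.
Qed.

Lemma v_integralV (F : finFieldType) (v : place F) (a : {poly F}) :
  ~~ (v %| a) -> v_integral v (tofrac a)^-1.
Proof. by move=> va; exists 1, a; rewrite tofrac1 div1r. Qed.

Lemma v_integralX (F : finFieldType) (v : place F) (x : {fraction {poly F}}) n :
  v_integral v x -> v_integral v (x ^+ n).
Proof.
move=> vx; elim: n => [|n IHn]; last by rewrite exprS; exact: v_integralM.
by rewrite expr0 -tofrac1; exact: v_integral_tofrac.
Qed.

Lemma Slt_integral (F : finFieldType) (v : place F) (s : seq int) :
  v_integral v (Slt F (deg v) s).
Proof.
apply: (big_ind (v_integral v)) => [|x y|t _].
- by rewrite -tofrac0; exact: v_integral_tofrac.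
- exact: v_integralD.
apply: (big_ind (v_integral v)) => [|x y|j _].
- by rewrite -tofrac1; exact: v_integral_tofrac.
- exact: v_integralM.
apply: (big_ind (v_integral v)) => [|x y|a /andP[am /eqP sa]].
- by rewrite -tofrac0; exact: v_integral_tofrac.
- exact: v_integralD.
have va : ~~ (v %| a).
  apply/negP => /(dvdp_leq (monic_neq0 am)); apply/negP; rewrite -ltnNge sa.
  by have := ltn_ord (tnth t j); rewrite /deg -ltnS prednK ?size_poly_gt0
    ?monic_neq0 ?(place_mi v).2.
have vX n : v_integral v (tofrac (a : {poly F}) ^+ n).
  by apply: v_integralX; exact: v_integral_tofrac.
case: (- s`_j)%R => n; first exact: vX.
by rewrite /exprz -exprVn; apply: v_integralX; exact: v_integralV.
Qed.

Definition zetaAK (F : finFieldType) (s : seq int) : AK F :=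
  toAK (fun v : place F => redK v (Slt F (deg v) s)).

Definition carlitz_theta (F : finFieldType) : {poly {poly F}} :=
  ('X : {poly F}) *: 'X + 'X^#|F|.

(* a = sum_i a_i theta^i is sent to sum_i a_i C_theta^i, the product on the
   target of the Carlitz module being the composition of polynomials. *)
Definition carlitz (F : finFieldType) (a : {poly F}) : {poly {poly F}} :=
  \sum_(i < size a)
    (a`_i)%:P *: iter i (fun P => carlitz_theta F \Po P) 'X.

Section Cinfty.
Context (F : finFieldType) (R : realType) (C : fieldType).
Context (iota : {rmorphism {fraction {poly F}} -> C}) (abs : C -> R).

Definition embA (a : {poly F}) : C := iota (tofrac a).

Definition cvgC (u : nat -> C) (l : C) : Prop :=
  (fun n => abs (u n - l)) @ \oo --> (0 : R).

Definition cauchyC (u : nat -> C) : Prop :=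
  forall e : R, 0 < e -> exists N, forall m n,
    (N <= m)%N -> (N <= n)%N -> abs (u m - u n) < e.

(* The Laurent series sum_i c_i theta^(m - i), i.e. F_r((1/theta)) *)
Definition Kinfty : set C :=
  [set x | exists (m : nat) (c : nat -> F),
    cvgC (fun n => \sum_(i < n) embA (c i)%:P * embA 'X ^+ m / embA 'X ^+ i) x].

Definition Kinfty_alg : set C :=
  [set x | exists P : {poly C},
    [/\ P != 0, forall i, Kinfty P`_i & root P x]].

(* C is the completion of an algebraic closure of F_r((1/theta)) *)
Record is_Cinfty : Prop := {
  abs_ge0 : forall x, 0 <= abs x;
  abs_eq0 : forall x, abs x = 0 <-> x = 0;
  absM : forall x y, abs (x * y) = abs x * abs y;
  absD : forall x y, abs (x + y) <= Num.max (abs x) (abs y);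
  abs_theta : abs (embA 'X) = #|F|%:R;
  Cinfty_complete : forall u, cauchyC u -> exists l, cvgC u l;
  Kinfty_alg_closed : forall P : {poly C}, (1 < size P)%N ->
    (forall i, Kinfty_alg P`_i) -> exists2 x, Kinfty_alg x & root P x;
  Kinfty_alg_dense : forall x (e : R), 0 < e ->
    exists2 y, Kinfty_alg y & abs (x - y) < e
}.

Definition carlitz_D (i : nat) : {poly F} :=
  \prod_(j < i) ('X^(#|F| ^ i) - 'X^(#|F| ^ j)).

(* The sum of the exponential series, which converges everywhere *)
Definition expC (z : C) : C :=
  xget 0 [set w |
    cvgC (fun n => \sum_(i < n) z ^+ (#|F| ^ i) / embA (carlitz_D i)) w].

(* These p are the generators of the rank one lattice ker exp_C, i.e. the
   Carlitz period up to a factor in F^*. *)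
Definition carlitz_period (p : C) : Prop :=
  p != 0 /\ forall z, expC z = 0 <-> exists a : {poly F}, z = p * embA a.

Definition lambda (p : C) (v : {poly F}) : C := expC (p / embA v).

Definition bracket (u : C) (a : {poly F}) : C :=
  (map_poly embA (carlitz a)).[u] / u.

Definition Hlt (d : nat) (s : seq int) (u : C) : C :=
  nested_sum (power_sum (bracket u)) d s.

Definition Aadjoin (u : C) : set C :=
  [set x | exists P : {poly {poly F}},
    x = (map_poly embA P).[u]].

(* The inverse of A/(v) -> A[u]/(u), a mod v |-> a mod u, applied to x mod u;
   meaningful when x is in A[u] and that map is an isomorphism, as it is for
   u = lambda_v. *)
Definition red_lambda (u : C) (v : place F) (x : C) : Fv v :=
  xget 0 [set y | exists a : {poly F},
    y = modv v a /\ exists2 w, Aadjoin u w & x = embA a + u * w].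

End Cinfty.

(* Main.v *)
(* Write lam for lambda_v. For b prime to v, C_b(lam) / lam is congruent to b modulo
   lam in A[lam]; it is a unit there, because C_c(C_b(lam)) = lam when c b = 1 mod v.
   Hence H_{<deg v}(s; lam) lies in A[lam] and reduces to the nested sum of the powers
   of the residues a mod v, as S_{<deg v}(s) does; equality holds at every place v.
   The reduction is well defined because lam is not a unit of A[lam]: v is the product
   of the -C_b(lam) over nonzero b of degree < deg v, each associate to lam, so if lam
   were a unit, 1/v would be integral over A. *)
Require Import Defs.
From HB Require Import structures.
From mathcomp Require Import all_boot all_order all_algebra all_field.
From mathcomp Require Import ring pgroup.
From mathcomp Require Import boolp classical_sets reals topology normedtype.
From mathcomp Require Import sequences realfun.

Set Implicit Arguments.
Unset Strict Implicit.
Unset Printing Implicit Defensive.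

Import Order.TTheory GRing.Theory Num.Theory numFieldNormedType.Exports.

Local Open Scope classical_set_scope.
Local Open Scope ring_scope.

(** * The Frobenius map of [F] on rings over [F] *)

(** [#|F|] is a power of the characteristic of [F], which [f] transports to [E]. *)
Lemma exprD_card (F : finFieldType) (E : comNzRingType) (f : {rmorphism F -> E})
    (x y : E) : (x + y) ^+ #|F| = x ^+ #|F| + y ^+ #|F|.
Proof.
have [p p_pr pF] := finPcharP F.
apply: exprDn_pchar; have pE := rmorph_pchar f pF.
rewrite (eq_pnat _ (pcharf_eq pE)).
by have := pprimeChar_pgroup pF; rewrite /pgroup cardsT.
Qed.

Lemma exprD_card_iter (F : finFieldType) (E : comNzRingType)
    (f : {rmorphism F -> E}) i (x y : E) :
  (x + y) ^+ (#|F| ^ i) = x ^+ (#|F| ^ i) + y ^+ (#|F| ^ i).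
Proof.
elim: i x y => [|i IHi] x y; first by rewrite !expr1.
by rewrite expnSr !exprM IHi (exprD_card f).
Qed.

Lemma expf_card_iter (F : finFieldType) (c : F) i : c ^+ (#|F| ^ i) = c.
Proof. by elim: i => [|i IHi]; rewrite ?expr1 // expnSr exprM IHi expf_card. Qed.

(** * Transfer of a relation through nested power sums *)

Section NestedSums.
Context (F : finFieldType) (E E' : fieldType) (rel : E -> E' -> Prop).
Context (rel0 : rel 0 0) (rel1 : rel 1 1).
Context (relD : forall x x' y y',
  rel x x' -> rel y y' -> rel (x + y) (x' + y')).
Context (relM : forall x x' y y',
  rel x x' -> rel y y' -> rel (x * y) (x' * y')).

(** This serves twice: for reduction modulo [v] on [K], and modulo [lambda_v] on [C]. Inverses are
    assumed termwise, because exponents have both signs and neither reduction is defined on all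
    inverses. *)
Lemma rel_nested_sum (f : {poly F} -> E) (f' : {poly F} -> E') d s :
  (forall a, a \is monic -> (size a <= d)%N ->
     rel (f a) (f' a) /\ rel (f a)^-1 (f' a)^-1) ->
  rel (nested_sum (power_sum f) d s) (nested_sum (power_sum f') d s).
Proof.
move=> ff'.
have relX x x' n : rel x x' -> rel (x ^+ n) (x' ^+ n).
  by move=> xx'; elim: n => // n IHn; rewrite !exprS; exact: relM.
apply: (big_rec2 rel) => // t y y' _ yy'; apply: relD yy'.
apply: (big_rec2 rel) => // j z z' _ zz'; apply: relM zz'.
apply: (big_rec2 rel) => // a w w' /andP[am /eqP sa] ww'; apply: relD ww'.
(* The index [tnth t j] lies in ['I_d], so [a] has degree less than [d]. *)
have [|fa fa'] := ff' a am; first by rewrite sa.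
by case: (- s`_j) => n; rewrite /exprz ?exprVn -?exprVn; apply: relX.
Qed.

End NestedSums.

(** * Reduction of [Slt] modulo [v] *)

(** This is the graph from which [redK] picks its value; as a relation it is stable under sums and
    products with no separate integrality condition. *)
Definition red_rel (F : finFieldType) (v : place F) (x : {fraction {poly F}})
    (y : Fv v) : Prop :=
  exists a b : {poly F},
    [/\ ~~ (v %| b), x = tofrac a / tofrac b & y = modv v a / modv v b].

Section RedK.
Context (F : finFieldType) (v : place F).

Lemma red_rel_tofrac (a : {poly F}) : red_rel (tofrac a) (modv v a).
Proof.
exists a, 1; split; first by rewrite -modv_eq0 rmorph1 oner_eq0.
  by rewrite tofrac1 divr1.
by rewrite rmorph1 divr1.
Qed.

Lemma red_relV (a : {poly F}) : ~~ (v %| a) -> red_rel (tofrac a)^-1 (modv v a)^-1.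
Proof. by move=> va; exists 1, a; rewrite tofrac1 rmorph1 !div1r. Qed.

Lemma red_relD x x' y y' :
  @red_rel F v x x' -> @red_rel F v y y' -> red_rel (x + y) (x' + y').
Proof.
move=> [a [b [vb -> ->]]] [c [d [vd -> ->]]]; exists (a * d + c * b), (b * d).
split; first by rewrite place_dvdM negb_or vb vd.
- by rewrite (addf_div _ _ (place_dvd_neq0 vb) (place_dvd_neq0 vd)) tofracD !tofracM.
- by rewrite addf_div ?modv_eq0 // rmorphD !rmorphM.
Qed.

Lemma red_relM x x' y y' :
  @red_rel F v x x' -> @red_rel F v y y' -> red_rel (x * y) (x' * y').
Proof.
move=> [a [b [vb -> ->]]] [c [d [vd -> ->]]]; exists (a * c), (b * d).
split; first by rewrite place_dvdM negb_or vb vd.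
  by rewrite mulf_div !tofracM.
by rewrite mulf_div !rmorphM.
Qed.

Lemma place_monicN (a : {poly F}) : a \is monic -> (size a <= deg v)%N -> ~~ (v %| a).
Proof.
move=> am; apply: contraL => /(dvdp_leq (monic_neq0 am)).
by rewrite -ltnNge /deg prednK // size_poly_gt0 monic_neq0 ?(place_mi v).2.
Qed.

(** A monic polynomial of degree less than [deg v] is prime to [v], so its inverse reduces to the
    inverse of its residue. *)
Lemma redK_Slt s :
  redK v (Slt F (deg v) s) = nested_sum (power_sum (modv v)) (deg v) s.
Proof.
have [a [b [vb -> ->]]] : red_rel (Slt F (deg v) s)
    (nested_sum (power_sum (modv v)) (deg v) s).
  apply: rel_nested_sum.
  - by have := red_rel_tofrac 0; rewrite tofrac0 rmorph0.
  - by have := red_rel_tofrac 1; rewrite tofrac1 rmorph1.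
  - exact: red_relD.
  - exact: red_relM.
  - by move=> a am sa; split; [exact: red_rel_tofrac | apply/red_relV/place_monicN].
exact: redKE.
Qed.

End RedK.

(** * Degrees and lowest terms of Carlitz polynomials; recursion for [D_i] *)

Section CarlitzPoly.
Context (F : finFieldType).
Local Notation q := #|F|.

Definition carlitz_iter i : {poly {poly F}} :=
  iter i (fun P => carlitz_theta F \Po P) 'X.

Lemma carlitzE (a : {poly F}) :
  carlitz a = \sum_(i < size a) (a`_i)%:P *: carlitz_iter i.
Proof. by []. Qed.

Lemma carlitz_iterS i : carlitz_iter i.+1 =
  ('X : {poly F}) *: carlitz_iter i + carlitz_iter i ^+ q.
Proof. by rewrite /= /carlitz_theta comp_polyD comp_polyZ comp_polyX comp_Xn_poly. Qed.

(** In the recursion the [q]-th power dominates: it has degree [q ^ i.+1], against [q ^ i] for the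
    other summand. *)
Lemma carlitz_iter_size i :
  carlitz_iter i \is monic /\ size (carlitz_iter i) = (q ^ i).+1.
Proof.
have q1 := finNzRing_gt1 F.
elim: i => [|i [mT sT]]; first by rewrite /= monicX size_polyX.
rewrite carlitz_iterS addrC.
have sTq : size (carlitz_iter i ^+ q) = (q ^ i.+1).+1.
  by rewrite polySpred ?monic_neq0 ?monic_exp // size_exp sT expnSr.
have lt : (size ('X *: carlitz_iter i) < size (carlitz_iter i ^+ q))%N.
  rewrite sTq; apply: leq_ltn_trans (size_scale_leq _ _) _.
  by rewrite sT ltnS ltn_exp2l.
by rewrite monicE lead_coefDl // -monicE monic_exp // size_polyDl.
Qed.

(** The summand of the leading coefficient dominates. For [a = v] this gives integrality of
    [lambda_v] and the number of roots of [C_v]. *)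
Lemma carlitz_monic_size (a : {poly F}) : a \is monic ->
  carlitz a \is monic /\ size (carlitz a) = (q ^ (size a).-1).+1.
Proof.
move=> am; have a0 : (0 < size a)%N by rewrite size_poly_gt0 monic_neq0.
rewrite carlitzE; move: (monicP am); rewrite /lead_coef.
move: (size a) a0 => [//|n] _ /= an.
have [mT sT] := carlitz_iter_size n.
rewrite big_ord_recr /= an scale1r addrC.
set B := \sum_(i < n) _.
have lt : (size B < size (carlitz_iter n))%N.
  rewrite sT ltnS; apply: leq_trans (size_sum _ _ _) _.
  apply/bigmax_leqP => i _; apply: leq_trans (size_scale_leq _ _) _.
  by rewrite (carlitz_iter_size i).2 ltn_exp2l ?finNzRing_gt1.
by rewrite monicE lead_coefDl // -monicE size_polyDl.
Qed.

Lemma carlitz_iter_mulX i : exists W : {poly {poly F}},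
  carlitz_iter i = 'X * (('X^i)%:P + 'X * W).
Proof.
elim: i => [|i [W TW]].
  by exists 0; rewrite /= mulr0 addr0 mulr1.
have [q2 q2E] : exists q2, q = q2.+2.
  by have := finNzRing_gt1 F; case: #|F| => [|[|q2]] // _; exists q2.
(* Here [q2] is [q - 2]: since [q >= 2], the [q]-th power in the recursion is divisible by [X ^ 2]
   and leaves the linear term alone. *)
exists (('X : {poly F})%:P * W + 'X^q2 * (('X^i)%:P + 'X * W) ^+ q).
rewrite carlitz_iterS TW exprMn [in 'X^q]q2E -mul_polyC.
rewrite !exprSr polyCM.
by ring.
Qed.

(** After division by [X] and evaluation at [u], this is the congruence of [[a]_u] with [a] modulo
    [u]. *)
Lemma carlitz_mulX (a : {poly F}) : exists W : {poly {poly F}},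
  carlitz a = 'X * (a%:P + 'X * W).
Proof.
pose W i := projT1 (cid (carlitz_iter_mulX i)).
have TW i : carlitz_iter i = 'X * (('X^i)%:P + 'X * W i).
  exact: projT2 (cid (carlitz_iter_mulX i)).
exists (\sum_(i < size a) (a`_i)%:P *: W i).
have aE : a%:P = \sum_(i < size a) (a`_i *: 'X^i)%:P.
  by rewrite -rmorph_sum -poly_def coefK.
rewrite carlitzE aE; under eq_bigr do rewrite TW.
rewrite mulr_sumr -big_split mulr_sumr /=.
apply: eq_bigr => i _; rewrite -!mul_polyC polyCM.
by ring.
Qed.

Lemma carlitz_D_neq0 i : carlitz_D F i != 0.
Proof.
apply/prodf_neq0 => j _; rewrite subr_eq0.
apply/eqP => /(congr1 (fun p : {poly F} => size p)).
rewrite !size_polyXn => -[] /eqP; rewrite eqn_exp2l ?finNzRing_gt1 //.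
by rewrite gtn_eqF.
Qed.

(** The factor [j = 0] is split off; by Frobenius every other factor is the [q]-th power of a factor
    of [carlitz_D F i]. *)
Lemma carlitz_DS i :
  carlitz_D F i.+1 = ('X^(q ^ i.+1) - 'X) * carlitz_D F i ^+ q.
Proof.
rewrite /carlitz_D big_ord_recl expr1 -prodrXl; congr (_ * _).
apply: eq_bigr => j _; rewrite -[RHS]/((_ + - _) ^+ _).
have sub (x y : {poly F}) : (x - y) ^+ q = x ^+ q - y ^+ q.
  by apply/eqP; rewrite eq_sym subr_eq -(exprD_card polyC) subrK.
by rewrite sub -!exprM -!expnSr.
Qed.

End CarlitzPoly.

(** * The embedding of [A] in [C], the rings [A[u]], and integrality over [A] *)

Section CinftyTheory.
Context (F : finFieldType) (R : realType) (C : fieldType).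
Context (iota : {rmorphism {fraction {poly F}} -> C}) (abs : C -> R).
Local Notation q := #|F|.
Local Notation embA := (Defs.embA iota).
Local Notation Aadjoin := (Defs.Aadjoin iota).

HB.instance Definition _ := GRing.RMorphism.copy embA (iota \o @tofrac _).

Lemma embA_eq0 a : (embA a == 0) = (a == 0).
Proof. by rewrite /embA fmorph_eq0 tofrac_eq0. Qed.

Lemma embA_inj : injective embA.
Proof. by move=> a b /eqP; rewrite -subr_eq0 -rmorphB embA_eq0 subr_eq0 => /eqP. Qed.

Definition carlitzC (a : {poly F}) (u : C) : C := (map_poly embA (carlitz a)).[u].

Definition carlitzC_iter i (u : C) : C := (map_poly embA (carlitz_iter F i)).[u].

Lemma carlitzC_iterS i u : carlitzC_iter i.+1 u =
  embA 'X * carlitzC_iter i u + carlitzC_iter i u ^+ q.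
Proof. by rewrite /carlitzC_iter carlitz_iterS rmorphD /= map_polyZ rmorphXn !hornerE. Qed.

Lemma carlitzCE a u :
  carlitzC a u = \sum_(i < size a) embA (a`_i)%:P * carlitzC_iter i u.
Proof.
rewrite /carlitzC carlitzE rmorph_sum horner_sum; apply: eq_bigr => i _.
by rewrite /= map_polyZ hornerZ.
Qed.

Section Adjoin.
Context (u : C).

Lemma Aadjoin_emb a : Aadjoin u (embA a).
Proof. by exists a%:P; rewrite map_polyC hornerC. Qed.

Lemma Aadjoin_gen : Aadjoin u u.
Proof. by exists 'X; rewrite map_polyX hornerX. Qed.

Lemma Aadjoin0 : Aadjoin u 0.
Proof. by rewrite -(rmorph0 embA); exact: Aadjoin_emb. Qed.

Lemma Aadjoin1 : Aadjoin u 1.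
Proof. by rewrite -(rmorph1 embA); exact: Aadjoin_emb. Qed.

Lemma AadjoinD x y : Aadjoin u x -> Aadjoin u y -> Aadjoin u (x + y).
Proof. by move=> [P ->] [Q ->]; exists (P + Q); rewrite rmorphD hornerD. Qed.

Lemma AadjoinM x y : Aadjoin u x -> Aadjoin u y -> Aadjoin u (x * y).
Proof. by move=> [P ->] [Q ->]; exists (P * Q); rewrite rmorphM hornerM. Qed.

Lemma AadjoinN x : Aadjoin u x -> Aadjoin u (- x).
Proof. by move=> [P ->]; exists (- P); rewrite rmorphN hornerN. Qed.

Lemma Aadjoin_horner (P : {poly {poly F}}) x :
  Aadjoin u x -> Aadjoin u (map_poly embA P).[x].
Proof. by move=> [Q ->]; exists (P \Po Q); rewrite map_comp_poly horner_comp. Qed.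

Lemma Aadjoin_integral x :
  integralOver embA u -> Aadjoin u x -> integralOver embA x.
Proof.
move=> intu [P ->]; apply: integral_horner intu; apply/integral_poly => i.
by rewrite coef_map; exact: integral_id.
Qed.

End Adjoin.

(** Multiplying a monic equation of degree [n] for [1 / a] by [a ^ n] leaves [1] plus multiples of
    [a]. *)
Lemma integral_embV (a : {poly F}) :
  a != 0 -> integralOver embA (embA a)^-1 -> a %| 1.
Proof.
move=> a0 [p pm /rootP]; have x0 : embA a != 0 by rewrite embA_eq0.
have p0 : (0 < size p)%N by rewrite size_poly_gt0 monic_neq0.
rewrite horner_coef size_map_poly_id0 ?(monicP pm) ?rmorph1 ?oner_eq0 //.
move: (monicP pm); rewrite /lead_coef; case: (size p) p0 => [//|n] _ /= pn.
move=> /(congr1 (fun y => y * embA a ^+ n)); rewrite mul0r mulr_suml.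
rewrite (eq_bigr (fun i : 'I_n.+1 => embA (p`_i * a ^+ (n - i)))); last first.
  move=> i _; rewrite coef_map rmorphM rmorphXn -mulrA; congr (_ * _).
  apply: (mulfI (expf_neq0 i x0)); rewrite exprVn mulVKf ?expf_neq0 //.
  by rewrite -exprD subnKC // -ltnS.
rewrite -rmorph_sum => /eqP; rewrite embA_eq0 big_ord_recr /= pn subnn mulr1.
rewrite addrC addr_eq0 => /eqP ->; rewrite dvdpNr.
apply: (big_ind (fun b => a %| b)) => [|b c|i _]; [exact: dvdp0 | exact: dvdp_add |].
by rewrite -[(n - i)%N]prednK ?subn_gt0 ?ltn_ord // exprS dvdp_mull ?dvdp_mulr.
Qed.

Lemma carlitzC_factor a : exists W : {poly {poly F}}, forall u,
  carlitzC a u = u * (embA a + u * (map_poly embA W).[u]).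
Proof.
have [W aW] := carlitz_mulX a; exists W => u.
by rewrite /carlitzC aW !(rmorphM, rmorphD) /= map_polyX map_polyC !hornerE.
Qed.

(** * Limits in [C] and the functional equation of the Carlitz exponential *)

Section Limits.
Context (hC : is_Cinfty iota abs).

Lemma abs0 : abs 0 = 0.
Proof. exact/(abs_eq0 hC). Qed.

Lemma abs1 : abs 1 = 1.
Proof.
have : abs 1 * abs 1 = abs 1 * 1 by rewrite -(absM hC) !mulr1.
by apply: mulfI; apply/eqP => /(abs_eq0 hC)/eqP; rewrite oner_eq0.
Qed.

Lemma absN x : abs (- x) = abs x.
Proof.
rewrite -mulN1r (absM hC); suff -> : abs (-1) = 1 by rewrite mul1r.
apply/eqP; rewrite -(@eqrXn2 _ 2%N) ?(abs_ge0 hC) //.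
by rewrite expr1n expr2 -(absM hC) mulrNN mulr1 abs1.
Qed.

Lemma absX x n : abs (x ^+ n) = abs x ^+ n.
Proof. by elim: n => [|n IHn]; rewrite ?expr0 ?abs1 // !exprS (absM hC) IHn. Qed.

Lemma abs_leD x y : abs (x + y) <= abs x + abs y.
Proof.
apply: le_trans (absD hC _ _) _.
by rewrite ge_max lerDl lerDr !(abs_ge0 hC).
Qed.

Local Notation cvgC := (Defs.cvgC abs).

Lemma cvgC_le (u : nat -> C) l (h : nat -> R) :
  (forall n, abs (u n - l) <= h n) -> (h @ \oo --> (0 : R)) -> cvgC u l.
Proof.
move=> uh h0; apply: (squeeze_cvgr _ (cvg_cst 0) h0).
by near=> n; rewrite uh (abs_ge0 hC).
Unshelve. all: by end_near. Qed.

Lemma cvgC_unique u l l' : cvgC u l -> cvgC u l' -> l = l'.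
Proof.
move=> ul ul'; suff : cvgC (fun=> l) l'.
  rewrite /Defs.cvgC => /(cvg_unique _ (cvg_cst _)) h.
  by apply/subr0_eq/(abs_eq0 hC)/h.
apply: (@cvgC_le _ _ (fun n => abs (u n - l) + abs (u n - l'))).
  move=> n; rewrite -[abs (u n - l)]absN opprB; apply: le_trans (abs_leD _ _).
  by rewrite addrA subrK.
by rewrite -[0 in X in _ --> X]addr0; exact: cvgD.
Qed.

Lemma cvgC_cst l : cvgC (fun=> l) l.
Proof. by rewrite /Defs.cvgC subrr abs0; exact: cvg_cst. Qed.

Lemma cvgC_D u u' l l' :
  cvgC u l -> cvgC u' l' -> cvgC (fun n => u n + u' n) (l + l').
Proof.
move=> ul ul'.
apply: (@cvgC_le _ _ (fun n => abs (u n - l) + abs (u' n - l'))).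
  by move=> n; rewrite opprD addrACA; exact: abs_leD.
by rewrite -[0 in X in _ --> X]addr0; exact: cvgD.
Qed.

Lemma cvgC_Z c u l : cvgC u l -> cvgC (fun n => c * u n) (c * l).
Proof.
move=> ul; apply: (@cvgC_le _ _ (fun n => abs c * abs (u n - l))).
  by move=> n; rewrite -mulrBr (absM hC).
by rewrite -[0 in X in _ --> X](mulr0 (abs c)); apply: cvgM => //; exact: cvg_cst.
Qed.

(** Frobenius is additive, so the error of the [q]-th powers is the [q]-th power of the error. *)
Lemma cvgC_frobenius u l : cvgC u l -> cvgC (fun n => u n ^+ q) (l ^+ q).
Proof.
move=> ul; have q0 : (0 < q)%N := ltnW (finNzRing_gt1 F).
apply: (@cvgC_le _ _ (fun n => abs (u n - l) ^+ q)).
  move=> n; rewrite -absX -{1}(subrK l (u n)).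
  by rewrite (exprD_card (embA \o polyC)) addrK.
have -> : (0 : R) = 0 ^+ q by rewrite expr0n gtn_eqF.
exact: (cvg_comp _ _ ul (@exprn_continuous R q 0)).
Qed.

Definition exp_sum (z : C) (n : nat) : C :=
  \sum_(i < n) z ^+ (q ^ i) / embA (carlitz_D F i).

Lemma exp_sumD z z' n : exp_sum (z + z') n = exp_sum z n + exp_sum z' n.
Proof.
rewrite -big_split; apply: eq_bigr => i _.
by rewrite (exprD_card_iter (embA \o polyC)) mulrDl.
Qed.

Lemma exp_sumZ (c : F) z n : exp_sum (embA c%:P * z) n = embA c%:P * exp_sum z n.
Proof.
rewrite mulr_sumr; apply: eq_bigr => i _.
by rewrite exprMn -!rmorphXn expf_card_iter mulrA.
Qed.

(** Finite form of [exp(theta z) = theta exp(z) + exp(z)^q]. By [carlitz_DS], the [q]-th power of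
    the term of index [i] is [theta^(q^(i+1)) - theta] times the term of index [i + 1], whence the
    shift from [n.+1] to [n]. *)
Lemma exp_sum_theta z n :
  exp_sum (embA 'X * z) n.+1 = embA 'X * exp_sum z n.+1 + exp_sum z n ^+ q.
Proof.
elim: n => [|n IHn].
  rewrite /exp_sum !big_ord_recr !big_ord0 /= !add0r !expr1.
  by rewrite expr0n gtn_eqF ?(ltnW (finNzRing_gt1 F)) // addr0 mulrA.
have DE y i : exp_sum y i.+1 = exp_sum y i + y ^+ (q ^ i) / embA (carlitz_D F i).
  by rewrite /exp_sum big_ord_recr.
have DEq : exp_sum z n.+1 ^+ q =
    exp_sum z n ^+ q + (z ^+ (q ^ n) / embA (carlitz_D F n)) ^+ q.
  by rewrite DE (exprD_card (embA \o polyC)).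
rewrite DE IHn [exp_sum z n.+2]DE DEq mulrDr.
set D1 := embA (carlitz_D F n.+1); set D := embA (carlitz_D F n).
suff -> : (embA 'X * z) ^+ (q ^ n.+1) / D1 =
    embA 'X * (z ^+ (q ^ n.+1) / D1) + (z ^+ (q ^ n) / D) ^+ q by ring.
have D10 : D1 != 0 by rewrite embA_eq0 carlitz_D_neq0.
have Dq0 : D ^+ q != 0 by rewrite expf_neq0 // embA_eq0 carlitz_D_neq0.
have D1E : D1 = (embA 'X ^+ (q ^ n.+1) - embA 'X) * D ^+ q.
  by rewrite /D1 carlitz_DS rmorphM rmorphB !rmorphXn.
have -> : (z ^+ (q ^ n) / D) ^+ q =
    (embA 'X ^+ (q ^ n.+1) - embA 'X) * (z ^+ (q ^ n.+1) / D1).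
  move: D10; rewrite expr_div_n -exprM -expnSr D1E mulf_eq0 negb_or => /andP[e0 _].
  by rewrite invfM [X in _ = _ * X]mulrCA mulVKf.
by rewrite exprMn; ring.
Qed.

(** Convergence is carried as a relation, because [expC] is also [0] where the series has no
    limit. *)
Definition exp_cvg (z w : C) := cvgC (exp_sum z) w.

Lemma exp_cvgP z w : exp_cvg z w -> expC iota abs z = w.
Proof. by move=> zw; apply: xget_unique => // w' /cvgC_unique; apply. Qed.

Lemma expC_cvg z : expC iota abs z != 0 -> exp_cvg z (expC iota abs z).
Proof. by rewrite /expC; case: xgetP => [w -> //|_]; rewrite eqxx. Qed.

Lemma exp_cvg_theta z w :
  exp_cvg z w -> exp_cvg (embA 'X * z) (embA 'X * w + w ^+ q).
Proof.
move=> zw; rewrite /exp_cvg /Defs.cvgC -cvg_shiftS.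
under eq_fun do rewrite exp_sum_theta.
apply: cvgC_D; last exact: cvgC_frobenius.
by apply: cvgC_Z; rewrite /Defs.cvgC (cvg_shiftS (fun n => abs (exp_sum z n - w))).
Qed.

Lemma exp_cvg_iter i z w :
  exp_cvg z w -> exp_cvg (embA 'X^i * z) (carlitzC_iter i w).
Proof.
move=> zw; elim: i => [|i IHi].
  by rewrite rmorph1 mul1r /carlitzC_iter /= map_polyX hornerX.
by rewrite carlitzC_iterS exprS rmorphM -mulrA; exact: exp_cvg_theta.
Qed.

(** The functional equation [exp(a z) = C_a(exp z)]: the partial sums are additive and [F]-linear in
    [z], which reduces it to powers of [theta]. *)
Lemma exp_cvg_carlitz a z w :
  exp_cvg z w -> exp_cvg (embA a * z) (carlitzC a w).
Proof.
move=> zw; rewrite carlitzCE.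
have -> : embA a * z = \sum_(i < size a) embA (a`_i)%:P * (embA 'X^i * z).
  rewrite -{1}[a]coefK poly_def rmorph_sum mulr_suml; apply: eq_bigr => i _.
  by rewrite mulrA -rmorphM mul_polyC.
apply: (big_ind2 exp_cvg).
- rewrite /exp_cvg (_ : exp_sum 0 = fun=> 0); first exact: cvgC_cst.
  apply: funext => n; apply: big1 => i _.
  by rewrite expr0n gtn_eqF ?mul0r // expn_gt0 (ltnW (finNzRing_gt1 F)).
- move=> z1 w1 z2 w2 h1 h2; rewrite /exp_cvg.
  rewrite (_ : exp_sum _ = fun n => exp_sum z1 n + exp_sum z2 n).
    exact: cvgC_D.
  by apply: funext => n; exact: exp_sumD.
- move=> i _; rewrite /exp_cvg.
  rewrite (_ : exp_sum _ = fun n => embA (a`_i)%:P * exp_sum (embA 'X^i * z) n).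
    by apply: cvgC_Z; exact: exp_cvg_iter.
  by apply: funext => n; exact: exp_sumZ.
Qed.

End Limits.

(** * The [v]-torsion point [lambda_v] and its multiples *)

Section Torsion.
Context (hC : is_Cinfty iota abs).
Context (pi : C) (hpi : carlitz_period iota abs pi) (v : place F).
Local Notation lam := (lambda iota abs pi v).

Lemma place_neq0 : (v : {poly F}) != 0.
Proof. exact: monic_neq0 (place_mi v).2. Qed.

Lemma place_dvd1 : ~~ (v %| 1).
Proof. by rewrite -modv_eq0 rmorph1 oner_eq0. Qed.

Lemma place_bezout (a : {poly F}) :
  ~~ (v %| a) -> exists b c : {poly F}, b * a = 1 + c * v.
Proof.
move=> va; have : coprimep v a by rewrite (irreducible_poly_coprime _ (place_mi v).1).
move=> /Bezout_eq1_coprimepP[[c b] /= cb]; exists b, (- c).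
by rewrite -cb mulNr addrAC subrr add0r.
Qed.

(** [b pi / v] lies in the lattice [pi A] exactly when [b / v] lies in [A]. *)
Lemma expC_torsion (b : {poly F}) :
  expC iota abs (embA b * (pi / embA v)) = 0 <-> v %| b.
Proof.
have [pi0 kerE] := hpi; have v0 : embA v != 0 by rewrite embA_eq0 place_neq0.
rewrite kerE; split=> [[a]|/dvdpP[a ->]]; last first.
  by exists a; rewrite rmorphM mulrCA mulfK.
rewrite mulrCA => /(mulfI pi0) /(canRL (mulfVK v0)).
by rewrite -rmorphM => /embA_inj ->; exact: dvdp_mull.
Qed.

Lemma lambda_neq0 : lam != 0.
Proof.
apply/eqP => lam0; have := place_dvd1; rewrite (_ : v %| 1) //.
by apply/expC_torsion; rewrite rmorph1 mul1r.
Qed.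

(* As [ker exp_C = pi A], convergence at [pi / v] comes from [exp_C (pi / v) <> 0]:
   a divergent series has the junk value [0]. *)
Lemma exp_cvg_lambda (b : {poly F}) :
  exp_cvg (embA b * (pi / embA v)) (carlitzC b lam).
Proof. exact/(exp_cvg_carlitz hC)/expC_cvg/lambda_neq0. Qed.

Lemma carlitzC_lambda_eq0 (b : {poly F}) : carlitzC b lam = 0 <-> v %| b.
Proof. by rewrite -(exp_cvgP hC (exp_cvg_lambda b)); exact: expC_torsion. Qed.

(** Both sides are limits of the exponential series at [c b pi / v], so uniqueness of limits stands
    in for the composition law of the Carlitz module. *)
Lemma carlitzC_comp (b c : {poly F}) :
  carlitzC c (carlitzC b lam) = carlitzC (c * b) lam.
Proof.
apply: (cvgC_unique hC) (exp_cvg_lambda (c * b)).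
by rewrite rmorphM -mulrA; apply/(exp_cvg_carlitz hC)/exp_cvg_lambda.
Qed.

Lemma carlitzC_lambdaB (b c : {poly F}) :
  carlitzC (b - c) lam = carlitzC b lam - carlitzC c lam.
Proof.
apply: (cvgC_unique hC) (exp_cvg_lambda (b - c)) _.
rewrite rmorphB mulrBl -mulN1r -(mulN1r (carlitzC c _)).
(* The sign is viewed as a scalar of [F], so that [exp_sumZ] applies. *)
have -> : -1 = embA (-1)%:P by rewrite polyCN polyC1 rmorphN1.
rewrite /exp_cvg (_ : exp_sum _ = fun n =>
    exp_sum (embA b * (pi / embA v)) n +
    embA (-1)%:P * exp_sum (embA c * (pi / embA v)) n); last first.
  by apply: funext => n; rewrite exp_sumD exp_sumZ.
apply: (cvgC_D hC); first exact: exp_cvg_lambda.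
by apply: (cvgC_Z hC); exact: exp_cvg_lambda.
Qed.

Lemma carlitzC1 : carlitzC 1 lam = lam.
Proof.
by rewrite -(exp_cvgP hC (exp_cvg_lambda 1)) rmorph1 mul1r.
Qed.

Lemma lambda_integral : integralOver embA lam.
Proof.
exists (carlitz v); first by rewrite (carlitz_monic_size (place_mi v).2).1.
by apply/rootP/carlitzC_lambda_eq0; exact: dvdpp.
Qed.

(** This makes [C_b(lam) / lam] a unit of [A[lam]]: [lam] is recovered as [C_c(C_b(lam))], hence is
    a multiple of [C_b(lam)] with cofactor congruent to [c]. *)
Lemma lambda_quotient (b : {poly F}) : ~~ (v %| b) ->
  exists c k : {poly F}, c * b = 1 + k * v /\
    exists2 w, Aadjoin lam w & lam / carlitzC b lam = embA c + lam * w.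
Proof.
move=> vb; have [c [k cb]] := place_bezout vb; exists c, k; split=> //.
set y := carlitzC b lam.
have y0 : y != 0 by apply/eqP => /carlitzC_lambda_eq0; exact/negP.
have [V cV] := carlitzC_factor c; have [W bW] := carlitzC_factor b.
have yE : carlitzC c y = lam.
  rewrite carlitzC_comp cb -[RHS]carlitzC1; apply/eqP.
  rewrite -subr_eq0 -carlitzC_lambdaB; apply/eqP/carlitzC_lambda_eq0.
  by rewrite addrAC subrr add0r dvdp_mull.
have Ag : Aadjoin lam (embA b + lam * (map_poly embA W).[lam]).
  apply: AadjoinD; first exact: Aadjoin_emb.
  by apply: AadjoinM; [exact: Aadjoin_gen | apply/Aadjoin_horner/Aadjoin_gen].
(* From [lam / y = c + y V(y)] and [y = lam (b + lam W(lam))], one factor [lam] is pulled out of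
   [y V(y)]. *)
exists ((embA b + lam * (map_poly embA W).[lam]) * (map_poly embA V).[y]).
  apply: AadjoinM => //; apply: Aadjoin_horner; rewrite /y bW.
  by apply: AadjoinM => //; exact: Aadjoin_gen.
by rewrite mulrA -bW -/y -{1}yE cV mulrAC mulfV // mul1r.
Qed.

(* The constant term of [C_v(X) / X] is [v], and its roots are the [C_b(lambda)]. *)
Lemma place_prod_carlitzC :
  embA v = \prod_(b : {poly_(deg v) F} | b != 0) - carlitzC b lam.
Proof.
pose x (b : {poly_(deg v) F}) := carlitzC b lam.
have [mC sC] := carlitz_monic_size (place_mi v).2.
have [W vW] := carlitz_mulX v.
have x_inj : injective x.
  move=> b c /eqP; rewrite -subr_eq0 -carlitzC_lambdaB => /eqP.
  move=> /carlitzC_lambda_eq0 vbc; apply/val_inj/eqP; rewrite -subr_eq0 /=.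
  apply: contraTT vbc => bc0; apply/negP => /(dvdp_leq bc0); apply/negP.
  rewrite -ltnNge -(prednK (_ : 0 < size v)%N) ?size_poly_gt0 ?place_neq0 //.
  apply: leq_ltn_trans (size_polyD _ _) _; rewrite size_polyN ltnS geq_max.
  by rewrite !size_npoly.
have : map_poly embA (carlitz v) = \prod_b ('X - (x b)%:P).
  rewrite [LHS](@all_roots_prod_XsubC _ _ (map x (enum {: {poly_(deg v) F}}))).
  - rewrite (monicP (monic_map embA mC)) scale1r big_map big_enum.
    by apply: eq_bigl => b; rewrite inE.
  - rewrite size_map_poly_id0; last by rewrite (monicP mC) rmorph1 oner_eq0.
    (* There are [q ^ deg v] polynomials of degree less than [deg v], as many as the degree of
       [C_v], so no other root remains. *)
    by rewrite size_map -cardE card_npoly sC.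
  - apply/allP => _ /mapP[b _ ->]; apply/rootP; rewrite -/(carlitzC v _).
    by rewrite carlitzC_comp; apply/carlitzC_lambda_eq0/dvdp_mulr/dvdpp.
  - by rewrite uniq_rootsE map_inj_uniq ?enum_uniq.
have x0 : x 0 = 0 by apply/carlitzC_lambda_eq0; exact: dvdp0.
(* The root [x 0 = 0] accounts for the factor [X] of [C_v(X)], which is cancelled before evaluating
   at [0]. *)
rewrite (bigD1 (0 : {poly_(deg v) F})) //= x0 subr0 vW.
rewrite rmorphM /= map_polyX => /(mulfI (negbT (polyX_eq0 _))).
move=> /(congr1 (fun p : {poly C} => p.[0])).
rewrite rmorphD rmorphM /= map_polyX map_polyC horner_prod !hornerE => ->.
by apply: eq_bigr => b _; rewrite !hornerE.
Qed.

Lemma lambda_nonunit : ~ Aadjoin lam lam^-1.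
Proof.
move=> Alam; have /negP := place_dvd1; apply.
apply: integral_embV; first exact: place_neq0.
apply: Aadjoin_integral lambda_integral _.
rewrite place_prod_carlitzC -prodfV; apply: big_ind.
- exact: Aadjoin1.
- exact: AadjoinM.
move=> b b0; have vb : ~~ (v %| b).
  move: b0; rewrite -(inj_eq val_inj) => b0; apply/negP => /(dvdp_leq b0).
  apply/negP; rewrite -ltnNge; apply: leq_ltn_trans (size_npoly b) _.
  by rewrite /deg prednK // size_poly_gt0 place_neq0.
have [c [_ [_ [w Aw cw]]]] := lambda_quotient vb.
(* The factor [lam / C_b(lam)] lies in [A[lam]] by [lambda_quotient], and [lam^-1] does by
   assumption. *)
have -> : (- carlitzC b lam)^-1 = - (lam^-1 * (lam / carlitzC b lam)).
  by rewrite mulKf ?lambda_neq0 // invrN.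
rewrite cw; apply/AadjoinN/AadjoinM => //; apply: AadjoinD; first exact: Aadjoin_emb.
by apply: AadjoinM => //; exact: Aadjoin_gen.
Qed.

(** * Reduction modulo [lambda_v] and the residue of [Hlt] *)

Definition lambda_rel (x : C) (y : Fv v) : Prop :=
  exists a : {poly F}, y = modv v a /\ exists2 w, Aadjoin lam w & x = embA a + lam * w.

Lemma lambda_rel_Aadjoin x y : lambda_rel x y -> Aadjoin lam x.
Proof.
move=> [a [_ [w Aw ->]]]; apply: AadjoinD; first exact: Aadjoin_emb.
by apply: AadjoinM => //; exact: Aadjoin_gen.
Qed.

Lemma lambda_rel_emb a : lambda_rel (embA a) (modv v a).
Proof. by exists a; split=> //; exists 0; rewrite ?mulr0 ?addr0 //; exact: Aadjoin0. Qed.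

Lemma lambda_relD x x' y y' :
  lambda_rel x x' -> lambda_rel y y' -> lambda_rel (x + y) (x' + y').
Proof.
move=> [a [-> [w Aw ->]]] [b [-> [z Az ->]]]; exists (a + b).
split; first by rewrite rmorphD.
by exists (w + z); [exact: AadjoinD | rewrite rmorphD mulrDr addrACA].
Qed.

Lemma lambda_relM x x' y y' :
  lambda_rel x x' -> lambda_rel y y' -> lambda_rel (x * y) (x' * y').
Proof.
move=> hx [b [-> [z Az ->]]]; have Ax := lambda_rel_Aadjoin hx.
have [a [-> [w Aw xE]]] := hx; exists (a * b).
split; first by rewrite rmorphM.
exists (embA b * w + x * z); last by rewrite xE rmorphM; ring.
by apply: AadjoinD; apply: AadjoinM => //; exact: Aadjoin_emb.
Qed.

(** If the residues differed, [a - b] would be prime to [v]. But [lam] divides both [a - b] and [v]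
    in [A[lam]], so a Bezout relation would make it a unit. *)
Lemma lambda_rel_unique x y y' : lambda_rel x y -> lambda_rel x y' -> y = y'.
Proof.
move=> [a [-> [w Aw ->]]] [b [-> [z Az e]]].
apply/eqP; rewrite -subr_eq0 -rmorphB modv_eq0; apply: contraT => vab.
have [c [k ck]] := place_bezout vab.
have [W vW] := carlitzC_factor v.
have eab : embA (a - b) = lam * (z - w).
  by rewrite rmorphB mulrBr; apply/eqP; rewrite subr_eq addrAC eq_sym subr_eq e addrC.
(* This is [C_v(lam) = 0] divided by [lam]. *)
have ev : embA v = - (lam * (map_poly embA W).[lam]).
  apply/eqP; rewrite -addr_eq0; apply/eqP/(mulfI lambda_neq0).
  by rewrite -vW mulr0; apply/carlitzC_lambda_eq0; exact: dvdpp.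
case: lambda_nonunit.
have -> : lam^-1 = embA c * (z - w) + embA k * (map_poly embA W).[lam].
  apply: (mulfI lambda_neq0); rewrite mulfV ?lambda_neq0 //.
  rewrite -(rmorph1 embA) -(addrK (k * v) 1) -ck rmorphB !rmorphM /= eab ev.
  by ring.
apply: AadjoinD; apply: AadjoinM; try exact: Aadjoin_emb.
  by apply: AadjoinD => //; exact: AadjoinN.
by apply: Aadjoin_horner; exact: Aadjoin_gen.
Qed.

Lemma red_lambdaP x y : lambda_rel x y -> red_lambda iota lam v x = y.
Proof. by move=> xy; apply: xget_unique => // y' /lambda_rel_unique; apply. Qed.

Lemma lambda_rel_bracket (b : {poly F}) : lambda_rel (bracket iota lam b) (modv v b).
Proof.
have [W bW] := carlitzC_factor b; exists b; split=> //.
exists (map_poly embA W).[lam]; first exact/Aadjoin_horner/Aadjoin_gen.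
by rewrite /bracket -/(carlitzC b lam) bW mulrAC mulfV ?lambda_neq0 // mul1r.
Qed.

(** The inverse bracket is [lam / C_b(lam)], whose residue [c] inverts [b] modulo [v]. *)
Lemma lambda_rel_bracketV (b : {poly F}) : ~~ (v %| b) ->
  lambda_rel (bracket iota lam b)^-1 (modv v b)^-1.
Proof.
move=> vb; have [c [k [cb [w Aw bw]]]] := lambda_quotient vb.
exists c; split; last by exists w => //; rewrite /bracket invf_div.
have mb0 : modv v b != 0 by rewrite modv_eq0.
apply: (mulIf mb0); rewrite mulVf // -rmorphM cb rmorphD rmorph1 rmorphM /=.
have /eqP -> : modv v v == 0 by rewrite modv_eq0.
by rewrite mulr0 addr0.
Qed.

(** The residue is the sum found for [Slt] in [redK_Slt]; the relation also carries membership in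
    [A[lam]], the other half of the theorem. *)
Lemma lambda_rel_Hlt s :
  lambda_rel (Hlt iota (deg v) s lam) (nested_sum (power_sum (modv v)) (deg v) s).
Proof.
apply: rel_nested_sum.
- by have := lambda_rel_emb 0; rewrite !rmorph0.
- by have := lambda_rel_emb 1; rewrite !rmorph1.
- exact: lambda_relD.
- exact: lambda_relM.
move=> a am sa; split; first exact: lambda_rel_bracket.
exact/lambda_rel_bracketV/place_monicN.
Qed.

End Torsion.
End CinftyTheory.

Theorem theorem3p19 (F : finFieldType) (R : realType) (C : fieldType)
    (iota : {rmorphism {fraction {poly F}} -> C}) (abs : C -> R)
    (hC : is_Cinfty iota abs)
    (pi : C) (hpi : carlitz_period iota abs pi)
    (s : seq int) :
  (forall v : place F,
     Aadjoin iota (lambda iota abs pi v)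
       (Hlt iota (deg v) s (lambda iota abs pi v))) /\
  zetaAK F s =
  toAK (fun v : place F =>
    red_lambda iota (lambda iota abs pi v) v
      (Hlt iota (deg v) s (lambda iota abs pi v))).
Proof.
split=> [v|]; first exact: lambda_rel_Aadjoin (lambda_rel_Hlt hC hpi v s).
rewrite /zetaAK; congr toAK; apply: functional_extensionality_dep => v.
by rewrite redK_Slt (red_lambdaP hC hpi (lambda_rel_Hlt hC hpi v s)).
Qed.
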